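(* Let $K$ be a field, $S=K[x_1,\ldots,x_n]$ the polynomial ring, and $I\subset S$ a monomial ideal. The following conditions (for given prime ideals $P_1,\dots,P_r$ of $S$ and $a_1,\dots,a_r\in\mathbb{N}^n$) are equivalent: (a) $S/I$ admits a multigraded prime filtration $\mathcal{F}:(0)=M_0\subset M_1\subset\cdots\subset M_{r-1}\subset M_r=S/I$ such that $M_i/M_{i-1}\cong S/P_i(-a_i)$ for all $i$; (b) there exists a chain of monomial ideals $I=I_0\subset I_1\subset\cdots\subset I_r=S$ and monomials $u_i$ of multidegree $a_i$ such that $I_i=(I_{i-1},u_i)$ and $I_{i-1}:u_i=P_i$. If the equivalent conditions hold, then there exist irreducible monomial ideals $J_1,\ldots,J_r$ such that $I_i=\bigcap_{j=i+1}^rJ_j$ for $i=0,\ldots,r$. Moreover, if the prime filtration is pretty clean, then this set of irreducible ideals $\{J_1,\ldots,J_r\}$ is uniquely determined. In fact, this set corresponds bijectively to the set of facets of the multicomplex associated with $I$.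
   Context: A multigraded prime filtration of $S/I$ is a finite filtration by multigraded ($\mathbb{Z}^n$-graded) submodules with multigraded isomorphisms $M_i/M_{i-1}\cong S/P_i(-a_i)$, where each $P_i$ is a multigraded prime ideal. It is pretty clean if for all $i<j$ with $P_i\subset P_j$ one has $P_i=P_j$. The empty intersection of ideals is $S$. An ideal is irreducible if it is proper and not an intersection of two strictly larger ideals. $\mathbb{N}=\{0,1,2,\dots\}$, $\mathbb{N}_\infty=\mathbb{N}\cup\{\infty\}$, and $\mathbb{N}_\infty^n$ is ordered componentwise, with $c\le\infty$ for all $c$. A subset $\Gamma\subset\mathbb{N}_\infty^n$ is a multicomplex if (1) $a\in\Gamma$, $b\in\mathbb{N}_\infty^n$, $b\le a$ imply $b\in\Gamma$; and (2) $\Gamma$ contains the (componentwise) limit of every ascending sequence $a_1\le a_2\le\cdots$ of elements of $\Gamma$. $I(\Gamma)\subset S$ is the monomial ideal spanned over $K$ by all monomials $x^a$ with $a\in\mathbb{N}^n\setminus\Gamma$. Each monomial ideal $I$ equals $I(\Gamma)$ for a unique multicomplex $\Gamma$, called the multicomplex associated with $I$. For $a\in\mathbb{N}_\infty^n$ put $\operatorname{infpt}a=\{i: a(i)=\infty\}$. $\mathcal{M}(\Gamma)$ is the set of maximal elements of $\Gamma$. An element $a\in\Gamma$ is a facet of $\Gamma$ if $\operatorname{infpt}a=\operatorname{infpt}m$ for all $m\in\mathcal{M}(\Gamma)$ with $a\le m$. *)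

(* Defs.v *)
From HB Require Import structures.
From mathcomp Require Import all_boot all_order all_algebra.
From mathcomp Require Import generic_quotient ring_quotient.
From mathcomp Require Import boolp classical_sets functions.
From mathcomp Require Import mpoly.

Set Implicit Arguments.
Unset Strict Implicit.
Unset Printing Implicit Defensive.

Import Order.TTheory GRing.Theory Num.Theory.

Local Open Scope ring_scope.
Local Open Scope classical_set_scope.
Local Open Scope quotient_scope.

(* Submodules are Prop-valued sets; classical decidability of membership
   gives access to the boolean [Quotient.quot] and to sub-Lmodules. *)
Section Modules.
Variables (R : nzRingType) (M : lmodType R).

Definition is_submodule (N : set M) : Prop :=
  [/\ N 0, (forall x y, N x -> N y -> N (x + y))
    & (forall c x, N x -> N (c *: x))].

Definition generated (A : set M) : set M := smallest is_submodule A.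

Record submodule := Submodule {
  submodule_set :> set M;
  submoduleP : is_submodule submodule_set }.

Definition submodule_pred (N : submodule) : {pred M} :=
  fun x => x \in (N : set M).

Section OneSubmodule.
Variable N : submodule.

Fact submodule_addr_closed : addr_closed (submodule_pred N).
Proof.
have [N0 ND _] := submoduleP N.
split; first by rewrite /submodule_pred unfold_in mem_set.
by move=> x y; rewrite !unfold_in /submodule_pred !in_setE; apply: ND.
Qed.

Fact submodule_scaler_closed : GRing.scaler_closed (submodule_pred N).
Proof.
have [_ _ NZ] := submoduleP N.
by move=> c x; rewrite !unfold_in /submodule_pred !in_setE; apply: NZ.
Qed.

Fact submodule_oppr_closed : oppr_closed (submodule_pred N).
Proof. by move=> x Nx; rewrite -scaleN1r; apply: submodule_scaler_closed. Qed.

HB.instance Definition _ :=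
  GRing.isAddClosed.Build M (submodule_pred N) submodule_addr_closed.
HB.instance Definition _ :=
  GRing.isOppClosed.Build M (submodule_pred N) submodule_oppr_closed.
HB.instance Definition _ :=
  GRing.isScaleClosed.Build R M (submodule_pred N) submodule_scaler_closed.

Definition submodule_type := {x : M | x \in submodule_pred N}.

HB.instance Definition _ := SubChoice.on submodule_type.
HB.instance Definition _ :=
  [SubChoice_isSubLmodule of submodule_type by <:].

Definition quotient_module := Quotient.quot (submodule_pred N).

HB.instance Definition _ := EqQuotient.on quotient_module.
HB.instance Definition _ := GRing.Zmodule.on quotient_module.

Definition quotient_pi (x : M) : quotient_module := \pi_quotient_module x.

Fact quotient_piD x y : quotient_pi (x + y) = quotient_pi x + quotient_pi y.
Proof. exact: Quotient.pi_add. Qed.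

Fact quotient_pi_eq x y : quotient_pi x = quotient_pi y <-> (N : set M) (x - y).
Proof.
have -> : (N : set M) (x - y) = (x - y \in submodule_pred N).
  by rewrite unfold_in /submodule_pred in_setE.
by rewrite Quotient.idealrBE; split=> /eqP.
Qed.

Definition quotient_scale (c : R) (q : quotient_module) : quotient_module :=
  quotient_pi (c *: repr q).

Fact quotient_scale_pi c x :
  quotient_scale c (quotient_pi x) = quotient_pi (c *: x).
Proof.
have [_ _ NZ] := submoduleP N.
apply/quotient_pi_eq; rewrite -scalerBr; apply: NZ.
by apply/quotient_pi_eq; rewrite /quotient_pi reprK.
Qed.

Fact quotient_pi_surj q : exists x, q = quotient_pi x.
Proof. by exists (repr q); rewrite /quotient_pi reprK. Qed.

Fact quotient_scaleA c d q :
  quotient_scale c (quotient_scale d q) = quotient_scale (c * d) q.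
Proof.
by have [x ->] := quotient_pi_surj q; rewrite !quotient_scale_pi scalerA.
Qed.

Fact quotient_scale1 : left_id 1 quotient_scale.
Proof.
by move=> q; have [x ->] := quotient_pi_surj q; rewrite quotient_scale_pi scale1r.
Qed.

Fact quotient_scaleDr : right_distributive quotient_scale +%R.
Proof.
move=> c q s; have [x ->] := quotient_pi_surj q.
have [y ->] := quotient_pi_surj s.
by rewrite -quotient_piD !quotient_scale_pi scalerDr quotient_piD.
Qed.

Fact quotient_scaleDl q : {morph quotient_scale^~ q : c d / c + d}.
Proof.
move=> c d; have [x ->] := quotient_pi_surj q.
by rewrite !quotient_scale_pi scalerDl quotient_piD.
Qed.

HB.instance Definition _ := GRing.Zmodule_isLmodule.Build R quotient_module
  quotient_scaleA quotient_scale1 quotient_scaleDr quotient_scaleDl.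

End OneSubmodule.

End Modules.

Section Subquotient.
Variables (R : nzRingType) (M : lmodType R) (L N : submodule M).

Fact restrict_is_submodule :
  is_submodule [set x : submodule_type L | (N : set M) (val x)].
Proof.
have [N0 ND NZ] := submoduleP N.
by split=> [|x y|c x] //=; [apply: ND | apply: NZ].
Qed.

Definition restrict : submodule (submodule_type L) :=
  Submodule restrict_is_submodule.

(* L / (L `&` N), that is L / N when N is contained in L *)
Definition subquotient : lmodType R := quotient_module restrict.

End Subquotient.

Section Multigraded.
Variables (n : nat) (R : nzRingType).

Notation multidegree := {ffun 'I_n -> int}.

(* A grading is given by its homogeneous components M_d. No axiom is imposed:
   the only gradings used below come from [mpoly_grading] by submodules,
   quotients by multigraded submodules and shifts. *)
Definition multigrading (M : lmodType R) := multidegree -> set M.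

(* M(d)_b = M_(d + b) *)
Definition shift_grading (M : lmodType R) (d : multidegree)
  (g : multigrading M) : multigrading M := fun b => g (d + b).

Definition submodule_grading (M : lmodType R) (g : multigrading M)
  (L : submodule M) : multigrading (submodule_type L) :=
  fun d => [set x | g d (val x)].

Definition quotient_grading (M : lmodType R) (g : multigrading M)
  (N : submodule M) : multigrading (quotient_module N) :=
  fun d => quotient_pi N @` g d.

Definition subquotient_grading (M : lmodType R) (g : multigrading M)
  (L N : submodule M) : multigrading (subquotient L N) :=
  @quotient_grading _ (@submodule_grading _ g L) (restrict L N).

Definition multigraded_submodule (M : lmodType R) (g : multigrading M)
  (N : submodule M) : Prop :=
  forall x, (N : set M) x -> exists2 s : seq M,
    (forall y, y \in s -> (N : set M) y /\ exists d, g d y)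
    & x = \sum_(y <- s) y.

Definition multigraded_iso (M1 M2 : lmodType R)
  (g1 : multigrading M1) (g2 : multigrading M2) : Prop :=
  exists2 f : {linear M1 -> M2},
    bijective f & forall d x, g1 d x <-> g2 d (f x).

End Multigraded.

Arguments submodule_grading {n R M} g L.
Arguments quotient_grading {n R M} g N.
Arguments subquotient_grading {n R M} g L N.

Section Ideals.
Variables (K : fieldType) (n : nat).
Local Notation S := {mpoly K[n]}.

Definition ideal := submodule S^o.

Definition ideal_generated (A : set S) : set S := @generated S S^o A.

Definition colon (I : set S) (u : S) : set S := [set f | I (f * u)].

Definition is_proper (I : ideal) : Prop := (I : set S) != setT.

Definition prime_ideal (P : ideal) : Prop :=
  is_proper P /\ forall f g : S, (P : set S) (f * g) ->
    (P : set S) f \/ (P : set S) g.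

Definition irreducible_ideal (J : ideal) : Prop :=
  is_proper J /\
  ~ exists J1 J2 : ideal,
      [/\ (J : set S) `<` J1, (J : set S) `<` J2
        & (J : set S) = (J1 : set S) `&` J2].

Definition monomial_ideal (I : ideal) : Prop :=
  exists A : set 'X_{1..n},
    (I : set S) = ideal_generated [set 'X_[m] | m in A].

Definition multidegree_of (m : 'X_{1..n}) : {ffun 'I_n -> int} :=
  [ffun i => (m i)%:Z].

(* S_d = K x^d for d in N^n, and S_d = 0 otherwise *)
Definition mpoly_grading : multigrading n S^o :=
  fun d => [set f : S | forall m, m \in msupp f -> multidegree_of m = d].

Definition step_src r (i : 'I_r) : 'I_r.+1 := widen_ord (leqnSn r) i.
Definition step_tgt r (i : 'I_r) : 'I_r.+1 := lift ord0 i.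

(* P and a are indexed from 0: [P i], [a i] belong to the step from M_i to
   M_(i+1). *)
Definition prime_filtration (I : ideal) r (P : 'I_r -> ideal)
    (a : 'I_r -> 'X_{1..n}) (M : 'I_r.+1 -> submodule (quotient_module I)) :=
  [/\ [/\ (M ord0 : set _) = [set 0], (M ord_max : set _) = setT
        & forall i, (M (step_src i) : set _) `<=` M (step_tgt i)],
      forall i,
        multigraded_submodule (quotient_grading mpoly_grading I) (M i),
      forall i, prime_ideal (P i) /\ multigraded_submodule mpoly_grading (P i)
    & forall i, multigraded_iso
        (subquotient_grading (quotient_grading mpoly_grading I)
           (M (step_tgt i)) (M (step_src i)))
        (shift_grading (- multidegree_of (a i))
           (quotient_grading mpoly_grading (P i)))].

Definition pretty_clean_filtration (I : ideal) r (P : 'I_r -> ideal)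
    (a : 'I_r -> 'X_{1..n}) (M : 'I_r.+1 -> submodule (quotient_module I)) :=
  prime_filtration P a M /\
  forall i j : 'I_r, (i < j)%N -> (P i : set S) `<=` P j ->
    (P i : set S) = P j.

(* The monomial of multidegree a is 'X_[a], with coefficient 1. *)
Definition monomial_chain (I : ideal) r (P : 'I_r -> ideal)
    (a : 'I_r -> 'X_{1..n}) (C : 'I_r.+1 -> ideal) :=
  [/\ (C ord0 : set S) = I, (C ord_max : set S) = setT,
      forall i, monomial_ideal (C i),
      forall i, (C (step_src i) : set S) `<=` C (step_tgt i)
    & forall i,
        (C (step_tgt i) : set S)
          = ideal_generated ((C (step_src i) : set S) `|` [set 'X_[a i]])
        /\ colon (C (step_src i)) 'X_[a i] = P i].

(* With J indexed from 0, the intersection of the J_j for i < j <= r is over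
   the indices j >= i; it is S for i = r. *)
Definition irreducible_decomposition r (C : 'I_r.+1 -> ideal)
    (J : 'I_r -> ideal) :=
  (forall j, monomial_ideal (J j) /\ irreducible_ideal (J j)) /\
  forall i : 'I_r.+1,
    (C i : set S) = \bigcap_(j in [set j : 'I_r | (i <= j)%N]) (J j : set S).

End Ideals.

Section Multicomplexes.
Variable n : nat.

(* [None] is the infinite element of N_oo. *)
Definition natinf := option nat.

Definition le_natinf (x y : natinf) : bool :=
  match x, y with
  | _, None => true
  | Some b, Some c => (b <= c)%N
  | None, Some _ => false
  end.

Definition npoint := {ffun 'I_n -> natinf}.

Definition le_point (a b : npoint) : Prop := forall i, le_natinf (a i) (b i).

Definition natinf_limit (s : nat -> natinf) (l : natinf) : Prop :=
  match l with
  | Some c => exists N, forall k, (N <= k)%N -> s k = Some c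
  | None => forall c, exists N, forall k, (N <= k)%N -> le_natinf (Some c) (s k)
  end.

Definition multicomplex (G : set npoint) : Prop :=
  (forall a b, G a -> le_point b a -> G b) /\
  (forall (s : nat -> npoint) (l : npoint),
     (forall k, G (s k)) -> (forall k, le_point (s k) (s k.+1)) ->
     (forall i, natinf_limit (fun k => s k i) (l i)) -> G l).

Definition point_of_mnm (m : 'X_{1..n}) : npoint := [ffun i => Some (m i)].

Definition multicomplex_ideal (K : fieldType) (G : set npoint) :
    set {mpoly K[n]} :=
  @generated K {mpoly K[n]} [set 'X_[m] | m in [set m | ~ G (point_of_mnm m)]].

Definition associated_multicomplex (K : fieldType) (I : ideal K n)
    (G : set npoint) : Prop :=
  multicomplex G /\ (I : set {mpoly K[n]}) = @multicomplex_ideal K G.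

Definition infpt (a : npoint) : {set 'I_n} := [set i | a i == None]%SET.

Definition maximal_points (G : set npoint) : set npoint :=
  [set m | G m /\ forall b, G b -> le_point m b -> b = m].

Definition facets (G : set npoint) : set npoint :=
  [set a | G a /\
    forall m, maximal_points G m -> le_point a m -> infpt a = infpt m].

(* The irreducible ideal (x_i ^ (a(i) + 1) : a(i) finite): its multicomplex
   is the set of all points below a. *)
Definition point_ideal (K : fieldType) (a : npoint) : set {mpoly K[n]} :=
  @multicomplex_ideal K [set b | le_point b a].

End Multicomplexes.

(* Main.v *)
(** Attach to the step I_i = (I_(i-1), x^a_i), I_(i-1) : x^a_i = P_i, the point
    b_i with b_i(k) = a_i(k) if x_k lies in P_i and b_i(k) = oo otherwise.
    Then I_(i-1) is the intersection of I_i with the irreducible ideal J_(b_i)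
    whose multicomplex consists of the points below b_i, and a monomial irreducible ideal J with
    J : x^a_i = P_i must be J_(b_i); so the J_i exist and are forced by the
    chain. In particular the multicomplex of I consists of the points below
    some b_i. Every facet is some b_i: choose a monomial which agrees with the
    facet on its finite coordinates and is large on the others, and look at the
    step at which it enters the chain. Conversely, if b_j <= b_l then P_l is
    contained in P_j; here l > j is impossible, since x^a_j lies in I_j, hence
    in J_(b_l), although a_j <= b_l; and for l < j pretty cleanness gives P_l = P_j, so that b_j and
    b_l have the same infinite coordinates. Filtrations of S/I correspond to
    chains by preimage and image: the inverse image of 1 under
    M_i/M_(i-1) = S/P_i(-a_i) is a scalar multiple of the class of x^a_i. *)

From HB Require Import structures.
Require Import Defs.
From mathcomp Require Import all_boot all_order all_algebra.
From mathcomp Require Import generic_quotient.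
From mathcomp Require Import boolp classical_sets functions.
From mathcomp Require Import mpoly.

Set Implicit Arguments.
Unset Strict Implicit.
Unset Printing Implicit Defensive.

Import GRing.Theory.

Local Open Scope ring_scope.
Local Open Scope classical_set_scope.

(** * Closure properties of submodules *)

Section Submodules.
Variables (R : nzRingType) (M : lmodType R).
Implicit Types L N : submodule M.

Lemma submodule0 N : submodule_set N 0.
Proof. by case: (submoduleP N). Qed.

Lemma submoduleD N x y :
  submodule_set N x -> submodule_set N y -> submodule_set N (x + y).
Proof. by case: (submoduleP N) => _ + _; apply. Qed.

Lemma submoduleZ N c x : submodule_set N x -> submodule_set N (c *: x).
Proof. by case: (submoduleP N) => _ _; apply. Qed.

Lemma submodule_sum N (T : eqType) (s : seq T) (p : pred T) (F : T -> M) :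
  (forall x, x \in s -> p x -> submodule_set N (F x)) ->
  submodule_set N (\sum_(x <- s | p x) F x).
Proof.
move=> sN; rewrite big_seq_cond; apply: (big_ind (submodule_set N)).
- exact: submodule0.
- exact: submoduleD.
- by move=> x /andP[]; apply: sN.
Qed.

End Submodules.

(** * Monomial ideals and their exponent sets *)

Section MonomialIdeals.
Variables (K : fieldType) (n : nat).
Local Notation S := {mpoly K[n]}.
Implicit Types (I J : ideal K n) (U : set 'X_{1..n}) (f g : S).

Lemma ideal0 I : submodule_set I 0.
Proof. exact: submodule0. Qed.

Lemma idealD I f g :
  submodule_set I f -> submodule_set I g -> submodule_set I (f + g).
Proof. exact: submoduleD. Qed.

Lemma idealMl I f g : submodule_set I g -> submodule_set I (f * g).
Proof. exact: submoduleZ. Qed.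

Lemma idealMr I f g : submodule_set I f -> submodule_set I (f * g).
Proof. by rewrite mulrC; apply: idealMl. Qed.

Lemma idealZ I c f : submodule_set I f -> submodule_set I (c *: f).
Proof. by rewrite -mul_mpolyC; apply: idealMl. Qed.

Lemma idealN I f : submodule_set I f -> submodule_set I (- f).
Proof. by rewrite -scaleN1r; apply: idealZ. Qed.

Lemma idealB I f g :
  submodule_set I f -> submodule_set I g -> submodule_set I (f - g).
Proof. by move=> If /idealN; apply: idealD. Qed.

Lemma ideal_sum I (T : eqType) (s : seq T) (p : pred T) (F : T -> S) :
  (forall x, x \in s -> p x -> submodule_set I (F x)) ->
  submodule_set I (\sum_(x <- s | p x) F x).
Proof. exact: submodule_sum. Qed.

Definition exponents I : set 'X_{1..n} := [set m | submodule_set I 'X_[m]].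

Lemma exponentsD I m k : exponents I m -> exponents I (m + k)%MM.
Proof. by rewrite /exponents /= mpolyXD; apply: idealMr. Qed.

Lemma exponents_le I m k : (m <= k)%MM -> exponents I m -> exponents I k.
Proof. by move=> /submK <- Im; rewrite addmC; apply: exponentsD. Qed.

Lemma exponents_sub I f :
  (forall m, m \in msupp f -> exponents I m) -> submodule_set I f.
Proof.
move=> sf; rewrite (mpolyE f); apply: ideal_sum => m mf _.
by apply: idealZ; apply: sf.
Qed.

Definition upward_closed U := forall m k, U m -> U (m + k)%MM.

Fact support_is_submodule U : upward_closed U ->
  @is_submodule _ S^o [set f : S | forall m, m \in msupp f -> U m].
Proof.
move=> upU; split=> /= [m|f g Uf Ug m|f g Ug m].
- by rewrite msupp0.
- by move/msuppD_le; rewrite mem_cat => /orP[/Uf|/Ug].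
- by move/msuppM_le => /allpairsP[[k l] /= [_ /Ug Ul ->]]; rewrite addmC;
    apply: upU.
Qed.

Definition support_ideal U (upU : upward_closed U) : ideal K n :=
  Submodule (support_is_submodule upU).

Lemma exponents_support_ideal U (upU : upward_closed U) m :
  exponents (support_ideal upU) m <-> U m.
Proof.
rewrite /exponents /=; split=> [|Um k]; first by apply; rewrite msuppX inE.
by rewrite msuppX inE => /eqP ->.
Qed.

Lemma generated_sub (A : set S) I :
  A `<=` submodule_set I -> ideal_generated A `<=` submodule_set I.
Proof. by apply: smallest_sub; apply: submoduleP. Qed.

Fact ideal_generated_is_submodule (A : set S) :
  @is_submodule _ S^o (ideal_generated A).
Proof.
split=> [B [[]]|f g Af Ag B [BP AB]|c f Af B [BP AB]] //.
  by case: (BP) => _ BD _; apply: BD; [apply: Af | apply: Ag].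
by case: (BP) => _ _; apply; apply: Af.
Qed.

Lemma sub_ideal_generated (A : set S) : A `<=` ideal_generated A.
Proof. exact: sub_gen_smallest. Qed.

Lemma support_closed_monomial I :
  (forall f m, submodule_set I f -> m \in msupp f -> exponents I m) ->
  monomial_ideal I.
Proof.
move=> sI; exists (exponents I); apply/seteqP; split=> [f If|].
  apply: (@exponents_sub (Submodule (ideal_generated_is_submodule _))) => m mf.
  apply: sub_ideal_generated; exists m => //; exact: sI mf.
by apply: generated_sub => _ [m Im <-].
Qed.

Lemma support_ideal_monomial U (upU : upward_closed U) :
  monomial_ideal (support_ideal upU).
Proof.
apply: support_closed_monomial => f m /= Uf mf.
by apply/exponents_support_ideal/Uf.
Qed.

(** The multiples of the generating monomials form an upward closed set [U], and the polynomials
    supported in [U] form an ideal that contains the generators, hence all of I. *)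
Lemma monomial_idealP I : monomial_ideal I -> forall f,
  submodule_set I f <-> forall m, m \in msupp f -> exponents I m.
Proof.
move=> [A IA] f; split; last exact: exponents_sub.
pose U := [set m | exists2 k, A k & (k <= m)%MM].
have upU : upward_closed U.
  by move=> m l [k Ak km]; exists k => //; apply: lepm_trans km (lem_addr _ _).
have sAI : ideal_generated [set 'X_[m] | m in A]
    `<=` submodule_set (support_ideal upU).
  apply: generated_sub => _ [m Am <-]; apply/(exponents_support_ideal upU).
  by exists m => //; apply: lepm_refl.
move=> If m mf; have [k Ak km] : U m by move: If; rewrite IA => /sAI /(_ m mf).
by apply: exponents_le km _; rewrite /exponents /= IA;
  apply: sub_ideal_generated; exists k.
Qed.

Lemma eq_monomial_ideal I J : monomial_ideal I -> monomial_ideal J ->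
  (forall m, exponents I m <-> exponents J m) -> (I : set S) = J.
Proof.
move=> mI mJ eqIJ; apply/seteqP.
by split=> f /monomial_idealP fP;
  apply/monomial_idealP => // m /fP => /(_ _)/eqIJ; apply.
Qed.

(** For the forward direction: the polynomials congruent modulo I to a multiple of x^a form an ideal
    that contains both I and x^a. *)
Lemma ideal_adjoinP I J a :
  (J : set S) = ideal_generated ((I : set S) `|` [set 'X_[a]]) ->
  forall p, submodule_set J p <-> exists h, submodule_set I (p - h * 'X_[a]).
Proof.
move=> JE p; split; last first.
  move=> [h Iph]; rewrite -(subrK (h * 'X_[a]) p); apply: idealD; last first.
    by apply: idealMl; rewrite JE; apply: sub_ideal_generated; right.
  by rewrite JE; apply: sub_ideal_generated; left.
rewrite JE; move: p; apply: smallest_sub => [|f [If|->]]; last 2 first.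
- by exists 0; rewrite mul0r subr0.
- by exists 1; rewrite mul1r subrr; apply: ideal0.
split=> [|f g [h1 f1] [h2 g2]|c f [h If]].
- by exists 0; rewrite mul0r subr0; apply: ideal0.
- by exists (h1 + h2); rewrite mulrDl opprD addrACA; apply: idealD.
- exists (c * h); rewrite -mulrA -[c *: f]/(c * f) -mulrBr; exact: idealMl.
Qed.

(** Either x^m occurs in x^m - h x^a, and the monomial ideal I contains it, or its coefficient in h
    x^a is 1, and x^m is a multiple of x^a. *)
Lemma exponents_subX I a m h : monomial_ideal I ->
  submodule_set I ('X_[m] - h * 'X_[a]) -> exponents I m \/ (a <= m)%MM.
Proof.
move=> mI /(monomial_idealP mI) Im.
have [/Im|] := boolP (m \in msupp ('X_[m] - h * 'X_[a])); first by left.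
move=> nm; right; move: nm;
  rewrite mcoeff_msupp mcoeffB mcoeffX eqxx negbK subr_eq0 eq_sym => /eqP hm.
have : m \in msupp (h * 'X_[a]) by rewrite mcoeff_msupp hm oner_neq0.
move/msuppM_le => /allpairsP[[k l] /= [_ + ->]].
by rewrite msuppX inE => /eqP ->; apply: lem_addl.
Qed.

Lemma exponents_adjoin I J a : monomial_ideal I ->
  (J : set S) = ideal_generated ((I : set S) `|` [set 'X_[a]]) ->
  forall m, exponents J m <-> exponents I m \/ (a <= m)%MM.
Proof.
move=> mI /ideal_adjoinP JP m; rewrite {1}/exponents /= JP.
split=> [[h]|[Im|am]]; first exact: exponents_subX.
  by exists 0; rewrite mul0r subr0.
by exists 'X_[m - a]; rewrite -mpolyXD submK // subrr; apply: ideal0.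
Qed.

Lemma proper_ideal_1 I : is_proper I -> ~ submodule_set I 1.
Proof.
move=> /eqP pI I1; apply: pI; apply/seteqP; split=> // f _.
by rewrite -[f]mulr1; apply: idealMl.
Qed.

(** By contraposition: the complement of P contains 1 and is closed under products, and x^t is a
    product of powers of variables. *)
Lemma prime_exponents P t : prime_ideal P -> exponents P t ->
  exists k, (0 < t k)%N /\ exponents P U_(k)%MM.
Proof.
move=> [/proper_ideal_1 P1 PM]; apply: contraPP => noP.
rewrite /exponents /= mpolyXE_id.
apply: (big_ind (fun f : S => ~ submodule_set P f)) =>
  // [f g nf ng /PM[]//|k _].
case: (posnP (t k)) => [->|tk]; first by rewrite expr0.
have Pk : ~ submodule_set P 'X_k by move=> Pk; apply: noP; exists k.
by elim: (t k) => [|e IHe]; rewrite ?expr0 // exprS => /PM[].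
Qed.

Lemma mulX_exponents I f a : monomial_ideal I ->
  submodule_set I (f * 'X_[a]) <-> forall m, m \in msupp f ->
    exponents I (m + a)%MM.
Proof.
move=> mI; rewrite (monomial_idealP mI); split=> [fI m mf|fI m].
  by apply: fI; rewrite addmC mcoeff_msupp mcoeffMX -mcoeff_msupp.
move/msuppM_le => /allpairsP[[k l] /= [kf + ->]].
by rewrite msuppX inE => /eqP ->; apply: fI.
Qed.

(** * The ideal J_b of a point b *)

Lemma le_point_mnm m (b : npoint n) :
  le_point (point_of_mnm m) b <-> forall k c, b k = Some c -> (m k <= c)%N.
Proof.
split=> le_mb k; first by move=> c bk; move: (le_mb k); rewrite ffunE bk.
by rewrite ffunE; case bk: (b k) => [c|//]; apply: le_mb bk.
Qed.

Lemma point_upward_closed (b : npoint n) :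
  upward_closed [set m | ~ le_point (point_of_mnm m) b].
Proof.
move=> m k /= nmb /le_point_mnm mkb; apply: nmb; apply/le_point_mnm => i c /mkb.
by rewrite mnmDE; apply: leq_trans; apply: leq_addr.
Qed.

(** This is [point_ideal] (see [point_idealE]), packaged as an [ideal] with membership expressed
    through supports. *)
Definition ideal_of_point (b : npoint n) : ideal K n :=
  support_ideal (@point_upward_closed b).

Lemma ideal_of_point_monomial b : monomial_ideal (ideal_of_point b).
Proof. exact: support_ideal_monomial. Qed.

Lemma exponents_ideal_of_point b m :
  exponents (ideal_of_point b) m <-> ~ le_point (point_of_mnm m) b.
Proof. exact: exponents_support_ideal. Qed.

Lemma multicomplex_idealE (G : set (npoint n)) :
  @multicomplex_ideal n K G
    = [set f : S | forall m, m \in msupp f -> ~ G (point_of_mnm m)].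
Proof.
apply/seteqP; split.
  apply: smallest_sub => [|_ [m nGm <-] k];
    last by rewrite msuppX inE => /eqP ->.
  split=> /= [m|f g Gf Gg m|c f Gf m]; first by rewrite msupp0.
    by move/msuppD_le; rewrite mem_cat => /orP[/Gf|/Gg].
  by move/msuppZ_le/Gf.
move=> f Gf B [[B0 BD BZ] GB]; rewrite (mpolyE f) big_seq.
apply: (big_ind B) => // m mf; apply: BZ; apply: GB; exists m => //; exact: Gf.
Qed.

Lemma point_idealE b : @point_ideal n K b = ideal_of_point b.
Proof. by rewrite /point_ideal multicomplex_idealE. Qed.

Lemma point_ideal_exponents b m :
  @point_ideal n K b 'X_[m] <-> ~ le_point (point_of_mnm m) b.
Proof. by rewrite point_idealE; apply: exponents_ideal_of_point. Qed.

(** * Irreducibility of J_b *)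

Section Irreducibility.
Variable b : npoint n.
Let restr (m : 'X_{1..n}) : 'X_{1..n} :=
  [multinom if b k is Some _ then m k else 0%N | k < n].
Let corner : 'X_{1..n} := [multinom odflt 0%N (b k) | k < n].

Let le_pointE m : le_point (point_of_mnm m) b <-> (restr m <= corner)%MM.
Proof.
rewrite le_point_mnm; split=> [mb|/mnm_lepP mb k c bk].
  apply/mnm_lepP => k; rewrite !mnmE; case bk: (b k) => [c|//=]; exact: mb bk.
by move: (mb k); rewrite !mnmE bk.
Qed.

Let restr_le m : (restr m <= m)%MM.
Proof. by apply/mnm_lepP => k; rewrite mnmE; case: (b k). Qed.

Let restrD m k : restr (m + k) = (restr m + restr k)%MM.
Proof. by apply/mnmP => i; rewrite !mnmE; case: (b i). Qed.

Let restr_corner : restr corner = corner.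
Proof. by apply/mnmP => i; rewrite !mnmE; case: (b i). Qed.

(* The quotient of S by the ideal is free over the polynomials in the variables with
   infinite coordinate, and the multiples of x^corner form its socle: a
   monomial factor moves the terms of f of least restricted degree into it
   and kills the others. *)
Lemma ideal_of_point_corner f : ~ submodule_set (ideal_of_point b) f ->
  exists h g, [/\ g != 0, (forall m, m \in msupp g -> restr m = 0%MM)
    & submodule_set (ideal_of_point b) (h * f - g * 'X_[corner])].
Proof.
move=> nJf.
have [m0 m0f m0b] : exists2 m, m \in msupp f & le_point (point_of_mnm m) b.
  by apply: contra_notP nJf => noM m mf mb; apply: noM; exists m.
pose low d := has (fun m => (restr m <= corner)%MM && (mdeg (restr m) == d))
  (msupp f).
have /ex_minnP[d /hasP[m mf /andP[mb /eqP md]] mind] : exists d, low d.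
  exists (mdeg (restr m0)); apply/hasP; exists m0 => //; rewrite eqxx andbT.
  by apply/le_pointE.
(* Multiplication by x^q carries the terms with restricted exponent p to multiples of x^corner. *)
pose p := restr m; pose q := (corner - p)%MM.
have pq : (p + q)%MM = corner by rewrite addmC submK.
have restrq : restr q = q.
  by apply/mnmP => i; rewrite !mnmE; case: (b i).
exists 'X_[q], (\sum_(l <- msupp f | restr l == p) f@_l *: 'X_[l - p]).
have in_J : submodule_set (ideal_of_point b) ('X_[q] * f -
    (\sum_(l <- msupp f | restr l == p) f@_l *: 'X_[l - p]) * 'X_[corner]).
  rewrite {1}(mpolyE f) mulr_sumr (bigID (fun l =>
    restr l == p)) /= [X in X - _]addrC.
  rewrite mulr_suml -addrA -sumrB [X in _ + X]big1 ?addr0 => [|l /eqP lp].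
    apply: (@ideal_sum (ideal_of_point b)) => l lf nlp;
      rewrite -scalerAr -mpolyXD.
    apply: idealZ; apply/exponents_ideal_of_point => /le_pointE.
    rewrite restrD restrq => lb.
    (* A term that stays outside the ideal after multiplication by x^q has a restricted exponent
       below p; minimality of the degree of p forces equality. *)
    have lp : (restr l <= p)%MM.
      apply/mnm_lepP => i; move/mnm_lepP: lb => /(_ i).
      by rewrite -pq !mnmDE addnC leq_add2r.
    have /mind : low (mdeg (restr l)).
      apply/hasP; exists l => //; rewrite eqxx andbT.
      exact: lepm_trans lp mb.
    rewrite -md -[restr m]/p -(submK lp) mdegD -{2}[mdeg (restr l)]add0n
      leq_add2r.
    rewrite leqn0 mdeg_eq0 => /eqP pl0; case/eqP: nlp.
    by rewrite -(submK lp) pl0 add0m.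
  have lE : (l - p + corner = q + l)%MM.
    have pl : (p <= l)%MM by rewrite -lp restr_le.
    by rewrite -pq addmA (submK pl) addmC.
  by rewrite -scalerAr -scalerAl -!mpolyXD lE subrr.
split=> //.
(* The term m of f survives, since m + q restricts to [corner]; so x^q f is not in the ideal. *)
- apply: contraTneq isT => g0; move: in_J; rewrite g0 mul0r subr0 mulrC.
  move/(mulX_exponents _ _ (@ideal_of_point_monomial b)) => /(_ m mf).
  move/exponents_ideal_of_point; case; apply/le_pointE.
  by rewrite restrD restrq pq lepm_refl.
- move=> l /msupp_sum_le /flattenP[s /mapP[k]];
    rewrite mem_filter => /andP[/eqP kp _] ->.
  move/msuppZ_le; rewrite msuppX inE => /eqP ->; apply: (@addIm _ (restr p)).
  rewrite -restrD submK -?kp ?restr_le // add0m.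
  by apply/mnmP => i; rewrite !mnmE; case: (b i).
Qed.

(** If J_b = J1 [&] J2 with both strictly larger, then J1 and J2 contain g1 x^corner and g2
    x^corner, where g1 and g2 are nonzero and involve only variables with infinite coordinate. Now
    g1 g2 x^corner lies in both, but not in J_b because g1 g2 is nonzero. *)
Lemma ideal_of_point_irreducible : irreducible_ideal (ideal_of_point b).
Proof.
have not_in g : g != 0 -> (forall m, m \in msupp g -> restr m = 0%MM) ->
    ~ submodule_set (ideal_of_point b) (g * 'X_[corner]).
  move=> g0 rg /(mulX_exponents _ _ (@ideal_of_point_monomial b)) Jg.
  have mg : mlead g \in msupp g by rewrite mlead_supp.
  have /exponents_ideal_of_point := Jg _ mg; apply; apply/le_pointE.
  by rewrite restrD (rg _ mg) add0m restr_corner lepm_refl.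
split.
  apply/eqP => J1; apply: (@not_in 1);
    [exact: oner_neq0 | move=> m | by rewrite J1].
  rewrite msupp1 inE => /eqP ->; apply/mnmP => i; rewrite !mnmE.
  by case: (b i).
move=> [J1 [J2 [[sJ1 /nonsubset[f1 [J1f1 nJf1]]] [sJ2 /nonsubset[f2 [J2f2
  nJf2]]] JE]]].
have [h1 [g1 [g1n0 rg1 Jg1]]] := ideal_of_point_corner nJf1.
have [h2 [g2 [g2n0 rg2 Jg2]]] := ideal_of_point_corner nJf2.
have J1g : submodule_set J1 (g1 * 'X_[corner]).
  rewrite -[_ * _](subKr (h1 * f1)); apply: idealB; first exact: idealMl.
  exact: sJ1.
have J2g : submodule_set J2 (g2 * 'X_[corner]).
  rewrite -[_ * _](subKr (h2 * f2)); apply: idealB; first exact: idealMl.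
  exact: sJ2.
apply: (@not_in (g1 * g2)); first by rewrite mulf_neq0.
  move=> m /msuppM_le /allpairsP[[k l] /= [/rg1 k0 /rg2 l0 ->]].
  by rewrite restrD k0 l0 add0m.
rewrite JE; split; last by rewrite -mulrA; apply: idealMl.
by rewrite mulrAC; apply: idealMr.
Qed.

End Irreducibility.

(* Otherwise J = (J, x^u) `&` (J, x^v). *)
Lemma irreducible_exponents J (u v : 'X_{1..n}) : monomial_ideal J ->
  irreducible_ideal J ->
  (forall k, u k = 0%N \/ v k = 0%N) -> exponents J (u + v)%MM ->
  exponents J u \/ exponents J v.
Proof.
move=> mJ [_ irrJ] uv0 Juv; apply: contrapT => /not_orP[nJu nJv]; apply: irrJ.
pose above w := [set m | exponents J m \/ (w <= m)%MM].
have upA w : upward_closed (above w).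
  move=> m k [Jm|wm]; [left; exact: exponentsD|right].
  exact: lepm_trans wm (lem_addr _ _).
have sJ w : (J : set S) `<=` support_ideal (upA w).
  by move=> f /(monomial_idealP mJ) Jf m /Jf Jm; left.
have properA w : ~ exponents J w -> (J : set S) `<` support_ideal (upA w).
  move=> nJw; split; first exact: sJ.
  move/(_ 'X_[w]) => sub; apply: nJw; apply: sub.
  by apply/(exponents_support_ideal (upA w)); right; apply: lepm_refl.
exists (support_ideal (upA u)), (support_ideal (upA v)); split.
- exact: properA.
- exact: properA.
apply/seteqP; split=> f; first by move=> Jf; split; apply: sJ.
case=> uf vf; apply/(monomial_idealP mJ) => m mf.
case: (uf m mf) => // /mnm_lepP um; case: (vf m mf) => // /mnm_lepP vm.
(* As x^u and x^v are coprime, a common multiple of both is a multiple of x^(u+v). *)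
apply: exponents_le Juv; apply/mnm_lepP => k; rewrite mnmDE.
by case: (uv0 k) => ->; rewrite ?add0n ?addn0.
Qed.

(** * The point b_i and the ideal J_(b_i) attached to one step of a chain *)

Definition corner_point (a : 'X_{1..n}) (P : ideal K n) : npoint n :=
  [ffun k => if `[< exponents P U_(k)%MM >] then Some (a k) else None].

(** The exponent m + a fails to be below b exactly when m is positive at some variable of P. *)
Lemma colon_ideal_of_corner a P m : prime_ideal P ->
  exponents (ideal_of_point (corner_point a P)) (m + a)%MM <-> exponents P m.
Proof.
move=> pP; rewrite exponents_ideal_of_point; split=> [|Pm].
  apply: contra_notP => nPm; apply/le_point_mnm => k c.
  rewrite ffunE; case: asboolP => // Pk [<-];
    rewrite mnmDE -{2}[a k]add0n leq_add2r.
  apply: contra_notT nPm; rewrite -ltnNge => mk; apply: exponents_le Pk.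
  by apply/mnm_lepP => i; rewrite mnm1E; case: eqP => // <-.
have [k [mk Pk]] := prime_exponents pP Pm.
move/le_point_mnm/(_ k (a k)); rewrite ffunE asboolT // => /(_ erefl).
by rewrite mnmDE -{2}[a k]add0n leq_add2r leqNgt mk.
Qed.

(** If x_k lies in P, then x_k x^a lies in J and factors into x_k^(a_k + 1) and a coprime divisor of
    x^a. By irreducibility one factor is in J; it is not the second, for then x^a would be in J and
    1 in P. So J contains the generators of J_b. The other inclusion passes from x^m to its part
    beyond x^a, which lies in P. *)
Lemma irreducible_colon_prime J P a :
  monomial_ideal J -> irreducible_ideal J -> prime_ideal P ->
  (forall m, exponents J (m + a)%MM <-> exponents P m) ->
  (J : set S) = ideal_of_point (corner_point a P).
Proof.
move=> mJ irrJ pP JP; apply: eq_monomial_ideal => // [|m].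
  exact: ideal_of_point_monomial.
rewrite exponents_ideal_of_point; split=> [Jm /le_point_mnm ma|].
  (* Subtraction is truncated, so m - a + a is the componentwise maximum of m and a. *)
  have /JP /(prime_exponents pP) [k [mk Pk]] : exponents J (m - a + a)%MM.
    apply: exponents_le Jm; apply/mnm_lepP => i.
    by rewrite mnmDE mnmBE addnC -leq_subLR.
  move: (ma k (a k)); rewrite ffunE asboolT // => /(_ erefl).
  by rewrite leqNgt -subn_gt0 -mnmBE mk.
move/le_point_mnm => nma; apply: contrapT => nJm; apply: nma => k c.
rewrite ffunE; case: asboolP => // Pk [<-]; rewrite leqNgt.
apply: contra_notN nJm => ak.
pose v : 'X_{1..n} := [multinom if i == k then 0%N else a i | i < n].
pose u : 'X_{1..n} := [multinom if i == k then (a k).+1 else 0%N | i < n].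
have uvE : (U_(k) + a = u + v)%MM.
  by apply/mnmP => i; rewrite !mnmE eq_sym; case: eqP => [->|] //;
    rewrite addn0 addnC addn1.
have : exponents J u \/ exponents J v.
  apply: irreducible_exponents => // [i|]; last by rewrite -uvE; apply/JP.
  by rewrite !mnmE; case: eqP; [right|left].
case=> [Ju|Jv].
  by apply: exponents_le Ju; apply/mnm_lepP => i; rewrite mnmE;
    case: eqP => // ->.
have /JP : exponents J (0 + a)%MM.
  rewrite add0m; apply: exponents_le Jv; apply/mnm_lepP => i.
  by rewrite mnmE; case: eqP.
by rewrite /exponents /= mpolyX0 => /proper_ideal_1; case; case: pP.
Qed.

End MonomialIdeals.

(** * The order on points, and points as limits of monomials *)

Section Points.
Variable n : nat.
Implicit Types (b c : npoint n) (m : 'X_{1..n}) (G : set (npoint n)).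

Lemma le_natinf_trans (y x z : natinf) :
  le_natinf x y -> le_natinf y z -> le_natinf x z.
Proof. by case: x y z => [x|] [y|] [z|] //=; apply: leq_trans. Qed.

Lemma le_point_refl b : le_point b b.
Proof. by move=> k; case: (b k) => /=. Qed.

Lemma le_point_trans c b d : le_point b c -> le_point c d -> le_point b d.
Proof. by move=> bc cd k; apply: le_natinf_trans (bc k) (cd k). Qed.

Lemma le_point_anti b c : le_point b c -> le_point c b -> b = c.
Proof.
move=> bc cb; apply/ffunP => k; move: (bc k) (cb k).
by case: (b k) (c k) => [x|] [y|] //= xy yx; congr Some; apply/eqP;
  rewrite eqn_leq xy.
Qed.

Lemma le_point_finite b c :
  (forall m, le_point (point_of_mnm m) b -> le_point (point_of_mnm m) c) ->
  le_point b c.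
Proof.
move=> bc k; case ck: (c k) => [d|]; last by case: (b k).
(* The test monomial is a power of x_k: its exponent is b(k) if that is finite, and otherwise d + 1,
   which is too large for c. *)
pose e := if b k is Some x then x else d.+1.
have : (([multinom if i == k then e else 0 | i < n] : 'X_{1..n}) k <= d)%N.
  have /le_point_mnm : le_point (point_of_mnm
      ([multinom if i == k then e else 0 | i < n])) b.
    by apply/le_point_mnm => i x bi; rewrite mnmE; case: eqP => // ik;
      rewrite /e -ik bi.
  move/(fun h => (le_point_mnm _ _).2 h)/bc/le_point_mnm; exact.
by rewrite mnmE eqxx /e; case: (b k) => [x|] //=; rewrite ltnn.
Qed.

Lemma infpt_mono b c : le_point b c -> infpt b \subset infpt c.
Proof.
move=> bc; apply/fintype.subsetP => k; rewrite !inE => /eqP bk.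
by move: (bc k); rewrite bk; case: (c k).
Qed.

(** The point b is the limit of its truncations min(b, t), which are finite, so closure under limits
    applies. *)
Lemma multicomplex_finite_points G b : multicomplex G ->
  G b <-> forall m, le_point (point_of_mnm m) b -> G (point_of_mnm m).
Proof.
move=> [Gdown Glim]; split=> [Gb m mb|Gm]; first exact: Gdown Gb mb.
pose s (t : nat) : 'X_{1..n} :=
  [multinom if b k is Some x then minn x t else t | k < n].
apply: (Glim (fun t => point_of_mnm (s t))) => [t|t k|k] /=.
- apply: Gm; apply/le_point_mnm => k x bk; rewrite mnmE bk; exact: geq_minl.
- rewrite !ffunE /= !mnmE; case: (b k) => [x|//].
  by rewrite leq_min geq_minl (leq_trans (geq_minr _ _)).
- case bk: (b k) => [x|] /=.
    by exists x => t xt; rewrite ffunE mnmE bk; congr Some; apply/minn_idPl.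
  by move=> x; exists x => t xt; rewrite ffunE mnmE bk.
Qed.

End Points.

(** * The multicomplex associated with an ideal *)

Section AssociatedMulticomplex.
Variables (K : fieldType) (n : nat) (I : ideal K n).
Local Notation S := {mpoly K[n]}.

Lemma point_ideal_inj (b c : npoint n) :
  @point_ideal n K b = @point_ideal n K c -> b = c.
Proof.
move=> bc; have bcE m : le_point (point_of_mnm m) b <->
  le_point (point_of_mnm m) c.
  split=> mb; apply: contrapT => /(@point_ideal_exponents K).
    by rewrite -bc => /(@point_ideal_exponents K).
  by rewrite bc => /(@point_ideal_exponents K).
by apply: le_point_anti; apply: le_point_finite => m /bcE.
Qed.

Lemma associated_multicomplexP (G : set (npoint n)) :
  associated_multicomplex I G ->
  forall b, G b <-> forall m, le_point (point_of_mnm m) b -> ~ exponents I m.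
Proof.
move=> [mG IG] b; rewrite multicomplex_finite_points //.
have IE m : exponents I m <-> ~ G (point_of_mnm m).
  rewrite /exponents /= IG multicomplex_idealE; split=> [|nGm k] /=.
    by apply; rewrite msuppX inE.
  by rewrite msuppX inE => /eqP ->.
by split=> bG m /bG; [move=> Gm /IE | move=> nIm; apply: contrapT => /IE].
Qed.

(** The uniqueness of the set of irreducible ideals mentions no multicomplex, but its proof compares
    both sets with the facets of this one. *)
Lemma associated_multicomplex_exists : monomial_ideal I ->
  exists G, associated_multicomplex I G.
Proof.
move=> mI; pose G : set (npoint n) :=
  [set b | forall m, le_point (point_of_mnm m) b -> ~ exponents I m].
have GE m : G (point_of_mnm m) <-> ~ exponents I m.
  split=> [|nIm k /le_point_mnm km Ik]; first by apply; apply: le_point_refl.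
  apply: nIm; apply: exponents_le Ik; apply/mnm_lepP => i.
  by apply: km; rewrite ffunE.
exists G; split; first split.
- by move=> b c Gb cb m mc; apply: Gb; apply: le_point_trans mc cb.
- move=> s l Gs _ sl m /le_point_mnm ml.
  (* From index [N k] on, coordinate k of the sequence is at least m(k); the maximum of the [N k]
     serves all coordinates. *)
  have /choice[N NP] k : exists N, forall t, (N <= t)%N ->
    le_natinf (Some (m k)) (s t k).
    move: (sl k); case lk: (l k) => [x|] /= lim; last exact: lim.
    by have [N NP] := lim; exists N => t /NP -> /=; apply: ml lk.
  apply: (Gs (\max_k N k)) => k; rewrite ffunE; apply: NP.
  exact: leq_bigmax.
- apply/seteqP; rewrite multicomplex_idealE; split=> f /= fI.
    by move=> m mf /GE; apply; apply: (monomial_idealP mI f).1 fI m mf.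
  by apply: exponents_sub => m /fI /GE /contrapT.
Qed.

End AssociatedMulticomplex.

(** * Chains of monomial ideals and their irreducible decompositions *)

Section Chains.
Variables (K : fieldType) (n : nat) (I : ideal K n) (r : nat).
Variables (P : 'I_r -> ideal K n) (a : 'I_r -> 'X_{1..n}).
Variable C : 'I_r.+1 -> ideal K n.
Hypothesis primeP : forall i, prime_ideal (P i).
Hypothesis chainC : monomial_chain I P a C.
Local Notation S := {mpoly K[n]}.

Let pt i := corner_point (a i) (P i).

Lemma chain_monomial i : monomial_ideal (C i).
Proof. by case: chainC. Qed.

Lemma chain_first m : exponents (C ord0) m <-> exponents I m.
Proof. by case: chainC => C0 *; rewrite /exponents /= C0. Qed.

Lemma chain_last m : exponents (C ord_max) m.
Proof. by case: chainC => _ Cr *; rewrite /exponents /= Cr. Qed.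

Lemma chain_colonE i f :
  submodule_set (C (step_src i)) (f * 'X_[a i]) <-> submodule_set (P i) f.
Proof. by case: chainC => _ _ _ _ /(_ i)[_ <-]. Qed.

Lemma chain_colon i m :
  exponents (C (step_src i)) (m + a i)%MM <-> exponents (P i) m.
Proof. by rewrite /exponents /= mpolyXD; apply: chain_colonE. Qed.

(** P_i is the colon of a monomial ideal by a monomial. *)
Lemma chain_prime_monomial i : monomial_ideal (P i).
Proof.
apply: support_closed_monomial => f m /chain_colonE Pf mf.
apply/chain_colon; exact: (mulX_exponents _ _ (chain_monomial _)).1 Pf m mf.
Qed.

Lemma chain_adjoin i m : exponents (C (step_tgt i)) m <->
  exponents (C (step_src i)) m \/ (a i <= m)%MM.
Proof.
apply: exponents_adjoin; first exact: chain_monomial.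
by case: chainC => _ _ _ _ /(_ i)[].
Qed.

Lemma chain_corner i : exponents (C (step_tgt i)) (a i).
Proof. by apply/chain_adjoin; right; apply: lepm_refl. Qed.

(** On multiples of x^a_i, both I_(i-1) and J_(b_i) are governed by their common colon P_i. Off
    these multiples I_i and I_(i-1) agree, and a monomial x^m of I_(i-1) must exceed a_i at some
    variable of P_i, hence lies in J_(b_i). *)
Lemma chain_inter i m : exponents (C (step_src i)) m <->
  exponents (C (step_tgt i)) m /\ exponents (ideal_of_point K (pt i)) m.
Proof.
rewrite chain_adjoin; case: (boolP (a i <= m)%MM) => [am|nam].
  rewrite -(submK am) chain_colon colon_ideal_of_corner //; split=> [?|[]//].
  by split=> //; right.
split=> [Cm|[[]//]]; split; first by left.
apply/exponents_ideal_of_point => /le_point_mnm mp.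
have /chain_colon : exponents (C (step_src i)) (m - a i + a i)%MM.
  apply: exponents_le Cm; apply/mnm_lepP => k.
  by rewrite mnmDE mnmBE addnC -leq_subLR.
move/(prime_exponents (primeP i)) => [k [mk Pk]].
move: (mp k (a i k)); rewrite ffunE asboolT // => /(_ erefl).
by rewrite leqNgt -subn_gt0 -mnmBE mk.
Qed.

Lemma chain_exponents (i : 'I_r.+1) m : exponents (C i) m <->
  forall j : 'I_r, (i <= j)%N -> exponents (ideal_of_point K (pt j)) m.
Proof.
have [k] : exists k, (i + k)%N = r by exists (r - i)%N; rewrite subnKC // -ltnS.
elim: k i => [|k IHk] i ikr.
  have -> : i = ord_max by apply: val_inj; rewrite /= -[LHS]addn0.
  split=> [_ j|_]; first by rewrite leqNgt ltn_ord.
  exact: chain_last.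
have ir : (i < r)%N by have := leq_addr k i.+1; rewrite addSnnS ikr.
have -> : i = step_src (Ordinal ir) by apply: val_inj.
rewrite chain_inter IHk /=; last by rewrite /bump /= add1n addSnnS.
split=> [[Cj Ci] j|Cj].
  rewrite leq_eqVlt => /orP[/eqP ij|]; last exact: Cj.
  by have <- : Ordinal ir = j by apply: val_inj.
by split=> [j /ltnW|]; apply: Cj => /=.
Qed.

Lemma chain_decomposition :
  irreducible_decomposition C (fun j => ideal_of_point K (pt j)).
Proof.
split=> [j|i].
  by split; [apply: ideal_of_point_monomial|apply: ideal_of_point_irreducible].
apply/seteqP; split=> f.
  move=> Cf j ij; apply: exponents_sub => m mf.
  move: j ij; apply/chain_exponents.
  exact: (monomial_idealP (chain_monomial i) f).1 Cf m mf.
move=> Jf; apply: exponents_sub => m mf; apply/chain_exponents => j ij.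
exact: (monomial_idealP (@ideal_of_point_monomial _ _ _) f).1 (Jf j ij) m mf.
Qed.

(** Every x^(m + a_j) lies in I_j, hence in all later members of the decomposition; so it lies in
    I_(j-1) exactly when it lies in J_j. Thus J_j has colon P_j by x^a_j, and
    [irreducible_colon_prime] applies. *)
Lemma decomposition_unique (J : 'I_r -> ideal K n) :
  irreducible_decomposition C J ->
  forall j, (J j : set S) = @point_ideal n K (pt j).
Proof.
move=> [Jirr CJ] j; have [mJ irrJ] := Jirr j; rewrite point_idealE.
apply: irreducible_colon_prime => // m; rewrite -chain_colon.
have : exponents (C (step_tgt j)) (m + a j)%MM.
  by apply: exponents_le (chain_corner j); apply: lem_addl.
rewrite /exponents /= !CJ => Jt; split=> [Jj l /= |]; last by apply => /=.
rewrite leq_eqVlt => /orP[/eqP jl|jl]; last exact: Jt.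
by have <- : j = l by apply: val_inj.
Qed.

(** The chain runs from I to S, so x^m has to enter at some step. *)
Lemma chain_step m : ~ exponents I m -> exists i,
  ~ exponents (C (step_src i)) m /\ exponents (C (step_tgt i)) m.
Proof.
move=> nIm; apply: contrapT => noi.
suff nC k (kr : (k < r.+1)%N) : ~ exponents (C (Ordinal kr)) m.
  apply: (nC r (ltnSn r)); have ->
    : Ordinal (ltnSn r) = ord_max by apply: val_inj.
  exact: chain_last.
elim: k kr => [|k IHk] kr.
  have -> : Ordinal kr = ord0 by apply: val_inj.
  by rewrite chain_first.
move=> Cm; apply: noi; exists (Ordinal (kr : (k < r)%N)); split.
  have -> : step_src (Ordinal (kr :
    (k < r)%N)) = Ordinal (ltnW kr) by apply: val_inj.
  exact: IHk.
by have -> : step_tgt (Ordinal (kr : (k < r)%N)) = Ordinal kr by apply: val_inj.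
Qed.

(** * Corner points and facets of the multicomplex *)

Section Facets.
Variable G : set (npoint n).
Hypothesis assocG : associated_multicomplex I G.

(** If b is below no b_j, a monomial below b that is large at the infinite coordinates of b is also
    below no b_j; it then lies in every J_(b_j), hence in I. *)
Lemma chain_multicomplex b : G b <-> exists j, le_point b (pt j).
Proof.
rewrite (associated_multicomplexP assocG); split=> [bI|[j bj] m mb].
  apply: contrapT => nbj.
  have /choice[k kP] j : exists k, ~~ le_natinf (b k) (pt j k).
    by apply: contra_notP nbj => nk; exists j => k;
      apply: contra_notT nk => ?; exists k.
  (* N exceeds each finite b_j(k_j), where k_j is a coordinate at which b is not below b_j. *)
  pose N := \max_j (odflt 0 (pt j (k j))).+1.
  pose m : 'X_{1..n} := [multinom if b i is Some x then x else N | i < n].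
  have mb : le_point (point_of_mnm m) b.
    by apply/le_point_mnm => i x bi; rewrite mnmE bi.
  apply: (bI m mb); apply/chain_first/chain_exponents => j _.
  apply/exponents_ideal_of_point => /(_ (k j)).
  rewrite [point_of_mnm _ _]ffunE mnmE; move: (kP j);
    case: (b (k j)) => [x /negP//|].
  case pj: (pt j (k j)) => [x|] //= _; rewrite leqNgt => /negP; apply.
  rewrite /N (bigD1 j) //= pj /= leq_max leqnn //.
rewrite -chain_first chain_exponents => /(_ j isT)/exponents_ideal_of_point;
  apply.
exact: le_point_trans mb bj.
Qed.

(** Among the finitely many b_j above b, one with the fewest b_l above it is maximal in G. *)
Lemma chain_maximal_points b : G b ->
  exists2 m, maximal_points G m & le_point b m.
Proof.
move=> /chain_multicomplex[j0 bj0].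
pose up j := [set l | `[< le_point (pt j) (pt l) >]]%SET.
have bj0P : `[< le_point b (pt j0) >] by apply/asboolP.
case: (arg_minnP (P := fun j => `[< le_point b (pt j) >]) (fun j =>
  #|up j|) bj0P).
move=> j /asboolP bj minj; exists (pt j) => //.
split=> [|c Gc jc]; first by apply/chain_multicomplex; exists j;
  apply: le_point_refl.
apply: le_point_anti (jc); have /chain_multicomplex[l cl] := Gc.
apply: le_point_trans (cl) _; have jl := le_point_trans jc cl.
have sub : up l \subset up j.
  by apply/fintype.subsetP => t; rewrite !inE; apply: le_point_trans.
have eq_up : up l = up j.
  apply/eqP; rewrite eqEcard sub minj //; apply/asboolP;
    exact: le_point_trans bj jl.
have : j \in up l by rewrite eq_up !inE; apply: le_point_refl.
by rewrite !inE.
Qed.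

(** The monomial x^m, with m equal to b where b is finite and to N elsewhere, enters the chain at
    some step i; thus a_i <= m <= b_i, and this b_i is shown to equal b. *)
Lemma facet_corner b : facets G b -> exists i, b = pt i.
Proof.
(* N exceeds all finite coordinates of all b_j, so m <= b_i makes b_i infinite wherever b is. *)
move=> [Gb fb]; pose N := \max_j \max_k (odflt 0 (pt j k)).+1.
have ltN j k x : pt j k = Some x -> (x < N)%N.
  move=> jk; rewrite /N (bigD1 j) //= leq_max (bigD1 k) //= jk /=.
  by rewrite leq_max leqnn.
pose m : 'X_{1..n} := [multinom if b i is Some x then x else N | i < n].
have mb : le_point (point_of_mnm m) b.
  by apply/le_point_mnm => i x bi; rewrite mnmE bi.
have nIm := (associated_multicomplexP assocG b).1 Gb m mb.
have [i [nCm /chain_adjoin[//|am]]] := chain_step nIm.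
have /le_point_mnm mi : le_point (point_of_mnm m) (pt i).
  move: nCm; rewrite -(submK am) chain_colon -(colon_ideal_of_corner (a i) _
    (primeP i)).
  by rewrite exponents_ideal_of_point => /contrapT.
exists i; have bi : le_point b (pt i).
  move=> k; case ik: (pt i k) => [x|]; last by case: (b k).
  move: (mi k x ik); rewrite mnmE; case: (b k) => [//|].
  by rewrite leqNgt (ltN _ _ _ ik).
(* A maximal point c above b_i is also above b, and the facet condition gives c the infinite
   coordinates of b; those of b_i lie in between. *)
have infE : infpt b = infpt (pt i).
  have [c cmax ic] : exists2 c, maximal_points G c & le_point (pt i) c.
    by apply: chain_maximal_points; apply/chain_multicomplex; exists i;
      apply: le_point_refl.
  apply/eqP; rewrite finset.eqEsubset infpt_mono //= (fb c cmax) ?infpt_mono //.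
  exact: le_point_trans bi ic.
(* At a finite coordinate, b <= b_i = a_i <= m = b. *)
apply/ffunP => k; move/setP: infE => /(_ k); rewrite !inE.
case bk: (b k) => [x|]; last by move/esym/eqP.
case ik: (pt i k) => [y|//] _; congr Some; apply/eqP; rewrite eqn_leq.
move: (bi k); rewrite bk ik /= => -> /=.
move/mnm_lepP: am => /(_ k); rewrite mnmE bk; move: ik.
by rewrite /pt ffunE; case: ifP => // _ [->].
Qed.

Hypothesis prettyP : forall i j : 'I_r, (i < j)%N ->
  (P i : set S) `<=` P j -> (P i : set S) = P j.

Lemma corner_facet j : facets G (pt j).
Proof.
split=> [|m [Gm maxm] jm].
  by apply/chain_multicomplex; exists j; apply: le_point_refl.
have [l ml] := (chain_multicomplex m).1 Gm.
have Gl : G (pt l) by apply/chain_multicomplex; exists l; apply: le_point_refl.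
(* The maximal point m is itself the corner point b_l. *)
rewrite -(maxm _ Gl ml) in jm *.
have infE (i : 'I_r) k : (k \in infpt (pt i)) = ~~ `[< exponents (P i) U_(k)%MM
  >].
  by rewrite inE ffunE; case: asboolP.
case: (ltngtP l j) => [lj|jl|/val_inj -> //]; last first.
  (* For l > j, x^a_j would lie in J_(b_l) although a_j <= b_j <= b_l. *)
  have /chain_exponents /(_ l jl) /exponents_ideal_of_point := chain_corner j;
    case.
  apply: le_point_trans jm; apply/le_point_mnm => k c.
  by rewrite ffunE; case: ifP => // _ [->].
(* The variables outside P_j are the infinite coordinates of b_j, which are infinite for b_l as
   well; so every variable of P_l lies in P_j. *)
have sPlj : (P l : set S) `<=` P j.
  move=> f /(monomial_idealP (chain_prime_monomial l)) Pf.
  apply: exponents_sub => t /Pf /(prime_exponents (primeP l)) [k [tk Pk]].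
  have Pjk : exponents (P j) U_(k)%MM.
    move/fintype.subsetP: (infpt_mono jm) => /(_ k); rewrite !infE => jlk.
    by apply/asboolP; apply: contraT => /jlk; rewrite asboolT.
  apply: exponents_le Pjk; apply/mnm_lepP => i; rewrite mnm1E.
  by case: eqP => // <-.
apply/setP => k; rewrite !infE; congr (~~ `[< _ >]).
by rewrite /exponents /= (prettyP lj sPlj).
Qed.

Lemma range_decomposition (J : 'I_r ->
  ideal K n) : irreducible_decomposition C J ->
  range (fun j => J j : set S) = @point_ideal n K @` facets G.
Proof.
move=> /decomposition_unique JE; apply/seteqP; split=> [_ [j _ <-]|_ [b Gb <-]].
  by exists (pt j); [apply: corner_facet|rewrite JE].
by have [j ->] := facet_corner Gb; exists j; rewrite ?JE.
Qed.

Lemma facets_bij (J : 'I_r -> ideal K n) : irreducible_decomposition C J ->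
  set_bij (facets G) (range (fun j => J j : set S)) (@point_ideal n K).
Proof.
move=> /range_decomposition ->.
by split=> [b Gb|b c _ _ /point_ideal_inj|//]; first by exists b.
Qed.

End Facets.

End Chains.

(** * Images and preimages of submodules under a quotient map *)

Section Quotients.
Variables (R : nzRingType) (M : lmodType R).
Implicit Types L N : submodule M.

Lemma quotient_piZ N c x : quotient_pi N (c *: x) = c *: quotient_pi N x.
Proof. by rewrite -quotient_scale_pi. Qed.

Lemma quotient_pi_0 N : quotient_pi N 0 = 0.
Proof. by apply: (addrI (quotient_pi N 0)); rewrite -quotient_piD !addr0. Qed.

Lemma quotient_piB N x y :
  quotient_pi N (x - y) = quotient_pi N x - quotient_pi N y.
Proof. by rewrite quotient_piD -scaleN1r quotient_piZ scaleN1r. Qed.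

Lemma quotient_pi_eq0 N x : quotient_pi N x = 0 <-> submodule_set N x.
Proof. by rewrite -(quotient_pi_0 N) quotient_pi_eq subr0. Qed.

Lemma quotient_pi_sum N (T : Type) (s : seq T) (F : T -> M) :
  quotient_pi N (\sum_(x <- s) F x) = \sum_(x <- s) quotient_pi N (F x).
Proof. exact: (big_morph _ (@quotient_piD _ _ N) (quotient_pi_0 N)). Qed.

Lemma mem_submodule_pred N x : submodule_set N x -> x \in submodule_pred N.
Proof. by move=> Nx; rewrite unfold_in /submodule_pred in_setE. Qed.

Lemma submodule_val L (z : submodule_type L) : submodule_set L (val z).
Proof. by have := valP z; rewrite unfold_in /submodule_pred in_setE. Qed.

Lemma subquotient_eq L N (y z : submodule_type L) :
  quotient_pi (Defs.restrict L N) y = quotient_pi (Defs.restrict L N) z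
  <-> submodule_set N (val y - val z).
Proof. by rewrite quotient_pi_eq -raddfB. Qed.

Fact image_is_submodule L N :
  is_submodule [set q : quotient_module N | exists2 x, submodule_set L x & q =
    quotient_pi N x].
Proof.
split=> [|_ _ [x Lx ->] [y Ly ->]|c _ [x Lx ->]].
- by exists 0; [apply: submodule0|rewrite quotient_pi_0].
- by exists (x + y); [apply: submoduleD|rewrite quotient_piD].
- by exists (c *: x); [apply: submoduleZ|rewrite quotient_piZ].
Qed.

Definition image_submodule L N : submodule (quotient_module N) :=
  Submodule (image_is_submodule L N).

Lemma image_submoduleE L N : (N : set M) `<=` L -> forall x,
  submodule_set (image_submodule L N) (quotient_pi N x) <-> submodule_set L x.
Proof.
move=> NL x; split=> [[y Ly /quotient_pi_eq/NL Lxy]|Lx]; last by exists x.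
by rewrite -(subrK y x); apply: submoduleD.
Qed.

Fact preimage_is_submodule N (L : submodule (quotient_module N)) :
  is_submodule [set x | submodule_set L (quotient_pi N x)].
Proof.
split=> [|x y|c x] /=.
  by rewrite quotient_pi_0; apply: submodule0.
  by rewrite quotient_piD; apply: submoduleD.
by rewrite quotient_piZ; apply: submoduleZ.
Qed.

Definition preimage_submodule N (L : submodule (quotient_module N)) :
  submodule M :=
  Submodule (preimage_is_submodule L).

Lemma preimage_image L N : (N : set M) `<=` L ->
  (preimage_submodule (image_submodule L N) : set M) = L.
Proof. by move=> NL; apply/seteqP; split=> x /(image_submoduleE NL x). Qed.

Lemma sub_preimage_submodule N (L : submodule (quotient_module N)) :
  (N : set M) `<=` preimage_submodule L.
Proof. by move=> x Nx; rewrite /= ((quotient_pi_eq0 N x).2 Nx);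
  apply: submodule0. Qed.

End Quotients.

(** * Multigraded submodules of S/I and monomial ideals *)

Section Filtrations.
Variables (K : fieldType) (n : nat).
Local Notation S := {mpoly K[n]}.
Implicit Types (I J P : ideal K n) (f g p : S) (a m : 'X_{1..n}).
Local Notation grading := (@mpoly_grading K n).

Lemma multidegree_of_inj : injective (@multidegree_of n).
Proof.
move=> m k /ffunP mk; apply/mnmP => i.
by have := mk i; rewrite !ffunE => -[].
Qed.

Lemma multidegree_ofD m k :
  multidegree_of (m + k)%MM = multidegree_of m + multidegree_of k.
Proof. by apply/ffunP => i; rewrite !ffunE mnmDE. Qed.

Lemma multidegree_of0 : @multidegree_of n 0%MM = 0.
Proof. by apply/ffunP => i; rewrite !ffunE mnm0E. Qed.

Lemma homogeneousP d f : grading d f ->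
  f = 0 \/ exists m c, [/\ multidegree_of m = d, c != 0 & f = c *: 'X_[m]].
Proof.
move=> df; have [->|f0] := eqVneq f 0; [by left|right].
have mf := mlead_supp f0; exists (mlead f), f@_(mlead f).
rewrite df // -mcoeff_msupp mf; split=> //.
rewrite [LHS]mpolyE (bigD1_seq (mlead f)) //= big_seq_cond big1 ?addr0 //.
move=> k /andP[kf /eqP]; case; apply: multidegree_of_inj; rewrite !df //.
Qed.

Lemma homogeneous_monomial m c : grading (multidegree_of m) (c *: 'X_[m]).
Proof. by move=> k /msuppZ_le; rewrite msuppX inE => /eqP ->. Qed.

Lemma homogeneous_mulX d f a :
  grading d f -> grading (d + multidegree_of a) (f * 'X_[a]).
Proof.
move=> df m /msuppM_le /allpairsP[[k l] /= [kf + ->]].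
by rewrite msuppX inE => /eqP ->; rewrite multidegree_ofD df.
Qed.

Lemma homogeneous0 d : grading d 0.
Proof. by move=> m; rewrite msupp0. Qed.

Lemma homogeneous_exponents J d f : grading d f -> submodule_set J f ->
  forall m, m \in msupp f -> exponents J m.
Proof.
move=> /homogeneousP[-> _ m|[k [c [_ c0 ->]]]]; first by rewrite msupp0.
move=> Jf m; rewrite msuppMCX // inE => /eqP ->.
by rewrite /exponents /= -['X_[k]](scalerK c0); apply: idealZ.
Qed.

Lemma monomial_ideal_multigraded J :
  monomial_ideal J -> multigraded_submodule grading J.
Proof.
move=> mJ f Jf; exists [seq f@_m *: 'X_[m] | m <- msupp f]; last first.
  by rewrite big_map -mpolyE.
move=> _ /mapP[m mf ->]; split; last by exists (multidegree_of m);
  apply: homogeneous_monomial.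
by apply: idealZ; apply: (monomial_idealP mJ f).1 Jf m mf.
Qed.

Lemma image_multigraded I J : monomial_ideal J ->
  multigraded_submodule (quotient_grading grading I) (image_submodule J I).
Proof.
move=> mJ _ [f Jf ->]; have [s sJ fE] := monomial_ideal_multigraded mJ Jf.
exists (map (quotient_pi I) s); last by rewrite big_map -quotient_pi_sum -fE.
move=> _ /mapP[y ys ->]; have [Jy [d dy]] := sJ y ys.
by split; [exists y|exists d; exists y].
Qed.

(** The class of f is a sum of homogeneous classes in N. Each has a homogeneous lift, a scalar
    multiple of a monomial that lies in the preimage, and f differs from the sum of the lifts by an
    element of the monomial ideal I. *)
Lemma preimage_monomial I (N : submodule (quotient_module I)) :
  monomial_ideal I ->
  multigraded_submodule (quotient_grading grading I) N ->
  monomial_ideal (preimage_submodule N).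
Proof.
move=> mI grN; set J := preimage_submodule N.
have upJ : upward_closed (exponents J) by move=> m k; apply: exponentsD.
have IJ : (I : set S^o) `<=` support_ideal K upJ.
  move=> f /(monomial_idealP mI) If m /If Im.
  exact: (sub_preimage_submodule (N : submodule (quotient_module I))).
apply: support_closed_monomial => f m /grN [s sN fE]; move: m.
suff: submodule_set (support_ideal K upJ) f by [].
apply/(image_submoduleE IJ); rewrite fE;
  apply: submodule_sum => y /sN[Ny [d [g dg yE]]] _.
exists g => // m mg; apply: homogeneous_exponents dg _ m mg.
by rewrite /J /= yE.
Qed.

(** * Graded isomorphisms of a factor with S/P(-a) *)

Section Iso.
Variables (I P : ideal K n) (Ms Mt : submodule (quotient_module I)).
Variable a : 'X_{1..n}.
Local Notation src_grading :=
  (subquotient_grading (quotient_grading grading I) Mt Ms).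
Local Notation tgt_grading :=
  (shift_grading (- multidegree_of a) (quotient_grading grading P)).

(** The inverse image [e] of 1 has multidegree a, because the shift moves degree 0 to a. A
    homogeneous lift h of it is nonzero, since 1 is not in P, so h = c x^a with c invertible. Hence
    x^a generates the factor, with annihilator P. *)
Lemma iso_cyclic : is_proper P -> multigraded_iso src_grading tgt_grading ->
  [/\ submodule_set (preimage_submodule Mt) 'X_[a],
      forall p, submodule_set (preimage_submodule Ms) (p * 'X_[a])
                <-> submodule_set P p
    & forall p, submodule_set (preimage_submodule Mt) p ->
        exists h, submodule_set (preimage_submodule Ms) (p - h * 'X_[a])].
Proof.
move=> /proper_ideal_1 nP1 [f [finv fK finvK] fgr].
pose e := finv (quotient_pi P 1).
have [z [h dh hz] ze] : src_grading (multidegree_of a) e.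
  apply/fgr; rewrite finvK; exists 1 => //.
  by move=> m; rewrite msupp1 inE => /eqP ->; rewrite addNr multidegree_of0.
have fZe p : f (p *: e) = quotient_pi P p.
  by rewrite linearZ /= finvK -quotient_piZ /= [_ *: _]mulr1.
have Zez p : p *: e = quotient_pi (Defs.restrict Mt Ms) (p *: z).
  by rewrite quotient_piZ ze.
have MsP p : submodule_set (preimage_submodule Ms) (p * h) <->
  submodule_set P p.
  rewrite -(quotient_pi_eq0 P p) -fZe.
  have -> : (f (p *: e) = 0) <-> (p *: e = 0).
    by split=> [fe|->]; [apply: (can_inj fK); rewrite fe|]; rewrite raddf0.
  by rewrite Zez quotient_pi_eq0 /= -hz -quotient_piZ.
have h0 : h != 0.
  apply: contra_notN nP1 => /eqP h0; apply/MsP; rewrite h0 mulr0;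
    exact: submodule0.
have [h00|[m [c [/multidegree_of_inj -> c0 hE]]]] := homogeneousP dh.
  by rewrite h00 eqxx in h0.
have XE : 'X_[a] = c^-1 *: h by rewrite hE scalerK.
have Mth : submodule_set (preimage_submodule Mt) h.
  by rewrite /= hz; apply: submodule_val.
split=> [|p|p Mtp].
- by rewrite XE; apply: idealZ.
- rewrite -MsP; split=> [|Msp]; last by rewrite XE -scalerAr; apply: idealZ.
  by rewrite hE -scalerAr; apply: idealZ.
- pose y : submodule_type Mt := Sub (quotient_pi I p) (mem_submodule_pred Mtp).
  have [q qE] := quotient_pi_surj (f (quotient_pi (Defs.restrict Mt Ms) y)).
  have : quotient_pi (Defs.restrict Mt Ms) y = quotient_pi (Defs.restrict Mt
    Ms) (q *: z).
    by rewrite -Zez; apply: (can_inj fK); rewrite fZe.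
  move/subquotient_eq; rewrite /= -hz -quotient_piZ => Mspq.
  exists (c *: q); rewrite -scalerAl scalerAr -hE /=.
  by rewrite quotient_piB.
Qed.

(** The class [e] of x^a generates the factor and has annihilator P, so p e -> p mod P is a
    well-defined linear bijection; the rest of the proof compares degrees. *)
Lemma cyclic_iso :
  submodule_set (preimage_submodule Mt) 'X_[a] ->
  (forall p, submodule_set (preimage_submodule Ms) (p * 'X_[a])
             <-> submodule_set P p) ->
  (forall p, submodule_set (preimage_submodule Mt) p ->
     exists h, submodule_set (preimage_submodule Ms) (p - h * 'X_[a])) ->
  monomial_ideal (preimage_submodule Ms) ->
  multigraded_iso src_grading tgt_grading.
Proof.
move=> Xa MsP MtP mMs.
pose z : submodule_type Mt :=
  Sub (quotient_pi I 'X_[a]) (mem_submodule_pred Xa).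
pose e := quotient_pi (Defs.restrict Mt Ms) z.
have Ze_eq p q : p *: e = q *: e <-> submodule_set P (p - q).
  by rewrite -!quotient_piZ subquotient_eq -MsP mulrBl /= quotient_piB
    -!quotient_piZ.
(* A monomial class of the factor is zero or a monomial multiple of [e]; this makes the isomorphism
   respect degrees. *)
have gen_monomial m c (y : submodule_type Mt) :
    val y = quotient_pi I (c *: 'X_[m]) -> c != 0 ->
    quotient_pi (Defs.restrict Mt Ms) y = 0 \/
    (a <= m)%MM /\ quotient_pi (Defs.restrict Mt Ms) y = (c *: 'X_[m - a]) *: e.
  move=> yE c0; have Mtm : exponents (preimage_submodule Mt) m.
    rewrite /exponents /= -['X_[m]](scalerK c0) -mul_mpolyC quotient_piZ -yE.
    by apply: submoduleZ; apply: submodule_val.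
  have [h /(exponents_subX mMs) [Msm|am]] := MtP _ Mtm; [left|right;
    split=> //].
    apply/quotient_pi_eq0; rewrite /= yE -mul_mpolyC quotient_piZ.
    exact: submoduleZ.
  rewrite -quotient_piZ; congr quotient_pi; apply: val_inj; rewrite /= yE.
  have -> : c *: 'X_[m] = (c *: 'X_[m - a]) * 'X_[a] :> S.
    by rewrite -scalerAl -mpolyXD submK.
  by rewrite -quotient_piZ.
have gen q : exists p, q = p *: e.
  have [y ->] := quotient_pi_surj q.
  have [g gE] := quotient_pi_surj (val y).
  have Mtg : submodule_set (preimage_submodule Mt) g.
    by rewrite /= -gE; apply: submodule_val.
  have [p Mp] := MtP g Mtg; exists p; rewrite -quotient_piZ;
    apply/subquotient_eq.
  by move: Mp; rewrite /= gE quotient_piB -quotient_piZ.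
have [h hP] := choice gen.
pose f q := quotient_pi P (h q).
have fZe p : f (p *: e) = quotient_pi P p.
  by apply/quotient_pi_eq/Ze_eq; rewrite -hP.
have lin_f : linear f.
  move=> c q t; rewrite {1}(hP q) {1}(hP t) scalerA -scalerDl fZe quotient_piD.
  by congr (_ + _); rewrite -quotient_piZ.
pose fL : {linear _ -> _} := HB.pack f (GRing.isLinear.Build _ _ _ _ f lin_f).
exists fL.
  exists (fun y => repr y *: e) => [q|y] /=.
    rewrite [RHS]hP; apply/Ze_eq/quotient_pi_eq; rewrite /quotient_pi reprK //.
  by rewrite fZe /quotient_pi reprK.
have tgt0 d : tgt_grading d 0.
  by exists 0; [apply: homogeneous0|rewrite quotient_pi_0].
(* Forward, a nonzero class of degree d comes from c x^m and is sent to c x^(m - a), of degree d -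
   a. Backward, a p of degree d - a gives p x^a of degree d. *)
move=> d q; split=> [[y [g dg gy] <-]|[p dp pq]].
  have [g0|[m [c [md c0 gE]]]] := homogeneousP dg.
    suff -> : quotient_pi (Defs.restrict Mt Ms) y = 0 by rewrite raddf0.
    by apply/quotient_pi_eq0; rewrite /= -gy g0 quotient_pi_0;
      apply: submodule0.
  rewrite gE in gy; have [->|[am ->]] := gen_monomial _ _ _ (esym gy) c0.
    by rewrite raddf0.
  rewrite /= fZe; exists (c *: 'X_[m - a]) => //.
  rewrite -md -{1}(submK am) multidegree_ofD addrC addrK.
  exact: homogeneous_monomial.
exists (p *: z); last first.
  by rewrite quotient_piZ [RHS]hP; apply/Ze_eq/quotient_pi_eq.
exists (p * 'X_[a]); last by rewrite /= -quotient_piZ.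
by have := @homogeneous_mulX _ _ a dp; rewrite addrAC addNr add0r.
Qed.

End Iso.

(** * Prime filtrations correspond to chains *)

Section Equivalence.
Variables (I : ideal K n) (r : nat) (P : 'I_r -> ideal K n) (a : 'I_r ->
  'X_{1..n}).
Hypothesis monomialI : monomial_ideal I.
Hypothesis primeP : forall i, prime_ideal (P i).

Lemma filtration_chain (M : 'I_r.+1 -> submodule (quotient_module I)) :
  prime_filtration P a M -> monomial_chain I P a (fun i =>
    preimage_submodule (M i)).
Proof.
move=> [[M0 Mr Mmono] grM _ isoM].
have cyclicM i := iso_cyclic (primeP i).1 (isoM i).
split=> /= [||i|i f|i].
- by apply/seteqP; rewrite /= M0; split=> f /=; rewrite quotient_pi_eq0.
- by apply/seteqP; rewrite /= Mr.
- exact: preimage_monomial.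
- exact: Mmono.
have [Xa MsP MtP] := cyclicM i; split; last first.
  by apply/seteqP; split=> f /MsP.
apply/seteqP; split=> [f Mf|].
  have [h Mfh] := MtP f Mf; rewrite -(subrK (h * 'X_[a i]) f).
  apply: (@idealD _ _ (Submodule (ideal_generated_is_submodule _))).
    by apply: sub_ideal_generated; left.
  apply: (@idealMl _ _ (Submodule (ideal_generated_is_submodule _))).
  by apply: sub_ideal_generated; right.
by apply: (@generated_sub _ _ _ (preimage_submodule (M (step_tgt i)))) =>
  f [/Mmono|->].
Qed.

(** As every I_i contains I, the preimage of I_i/I is I_i again, and the hypotheses of [cyclic_iso]
    become the chain conditions. *)
Lemma chain_filtration (C : 'I_r.+1 -> ideal K n) : monomial_chain I P a C ->
  prime_filtration P a (fun i => image_submodule (C i) I).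
Proof.
move=> chainC; have [C0 Cr mC Cmono adjC] := chainC.
have IC i : (I : set S^o) `<=` C i.
  case: i => k kr; elim: k kr => [|k IHk] kr.
    by rewrite -C0; have -> : Ordinal kr = ord0 by apply: val_inj.
  apply: subset_trans (IHk (ltnW kr)) _.
  have := Cmono (Ordinal (kr : (k < r)%N)); set s := step_src _;
    set t := step_tgt _.
  have -> : s = Ordinal (ltnW kr) by apply: val_inj.
  by have -> : t = Ordinal kr by apply: val_inj.
have preC i := preimage_image (@IC i).
split=> [|i|i|i].
- split.
  + apply/seteqP; split=> [_ [f Cf ->]|_ ->]; last exact: submodule0.
    by apply/quotient_pi_eq0; rewrite -C0.
  + apply/seteqP; split=> // q _; have [f ->] := quotient_pi_surj q.
    by exists f => //; rewrite Cr.
  + by move=> i _ [f /Cmono Cf ->]; exists f.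
- exact: image_multigraded.
- by split=> //; apply/monomial_ideal_multigraded/(chain_prime_monomial chainC).
have [adjE _] := adjC i.
apply: cyclic_iso; rewrite ?preC ?preC.
- exact: (chain_corner chainC).
- by move=> p; apply: (chain_colonE chainC).
- by move=> p; apply: (ideal_adjoinP adjE p).1.
- by have [A CA] := mC (step_src i); exists A; rewrite preC.
Qed.

End Equivalence.

End Filtrations.

Theorem proposition10p1 (K : fieldType) (n : nat) (I : ideal K n)
    (hI : monomial_ideal I) :
  [/\                  
      forall (r : nat) (P : 'I_r -> ideal K n) (a : 'I_r -> 'X_{1..n}),
        (forall i, prime_ideal (P i)) ->
        (exists M : 'I_r.+1 -> submodule (quotient_module I),
           prime_filtration P a M) <->
        (exists C : 'I_r.+1 -> ideal K n, monomial_chain I P a C),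
                                               
      forall (r : nat) (P : 'I_r -> ideal K n) (a : 'I_r -> 'X_{1..n})
             (C : 'I_r.+1 -> ideal K n),
        (forall i, prime_ideal (P i)) ->
        monomial_chain I P a C ->
        exists J : 'I_r -> ideal K n, irreducible_decomposition C J,
                                                                          
      forall (r r' : nat)
             (P : 'I_r -> ideal K n) (P' : 'I_r' -> ideal K n)
             (a : 'I_r -> 'X_{1..n}) (a' : 'I_r' -> 'X_{1..n})
             (M : 'I_r.+1 -> submodule (quotient_module I))
             (M' : 'I_r'.+1 -> submodule (quotient_module I))
             (C : 'I_r.+1 -> ideal K n) (C' : 'I_r'.+1 -> ideal K n)
             (J : 'I_r -> ideal K n) (J' : 'I_r' -> ideal K n),
        pretty_clean_filtration P a M -> pretty_clean_filtration P' a' M' ->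
        monomial_chain I P a C -> monomial_chain I P' a' C' ->
        irreducible_decomposition C J -> irreducible_decomposition C' J' ->
        range (fun j => J j : set {mpoly K[n]})
          = range (fun j => J' j : set {mpoly K[n]})
    &                                                               
      forall (r : nat) (P : 'I_r -> ideal K n) (a : 'I_r -> 'X_{1..n})
             (M : 'I_r.+1 -> submodule (quotient_module I))
             (C : 'I_r.+1 -> ideal K n) (J : 'I_r -> ideal K n)
             (G : set (npoint n)),
        pretty_clean_filtration P a M ->
        monomial_chain I P a C ->
        irreducible_decomposition C J ->
        associated_multicomplex I G ->
        set_bij (facets G) (range (fun j => J j : set {mpoly K[n]}))
          (@point_ideal n K)].
Proof.
split.
- move=> r P a pP; split=> [[M fM]|[C cC]].
    by exists (fun i => preimage_submodule (M i)); apply: filtration_chain.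
  by exists (fun i => image_submodule (C i) I); apply: chain_filtration.
- move=> r P a C pP cC.
  exists (fun j => ideal_of_point K (corner_point (a j) (P j))).
  exact: chain_decomposition cC.
- move=> r r' P P' a a' M M' C C' J J' [[_ _ pP _] prettyP] [[_ _ pP' _]
    prettyP'].
  (* Both sets of ideals are the image of the facets of one multicomplex associated with I. *)
  move=> cC cC' dJ dJ'; have [G assocG] := associated_multicomplex_exists hI.
  rewrite (range_decomposition (fun i => (pP i).1) cC assocG prettyP dJ).
  by rewrite (range_decomposition (fun i => (pP' i).1) cC' assocG prettyP' dJ').
- move=> r P a M C J G [[_ _ pP _] prettyP] cC dJ assocG.
  exact: (facets_bij (fun i => (pP i).1) cC assocG prettyP dJ).
Qed.
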